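(* Let $\mathcal{X}$ be a finite connected polygonal complex and let $\rho\colon\mathbb{R}_{\ge 0}\to\mathbb{R}_{\ge 0}$ be a rate function. Then the following are equivalent (with the same function $\rho$ in both): (i) $\mathcal{X}$ is $\rho$-cocycle stable; (ii) $\mathcal{X}$ is $\rho$-covering stable.
   Context: **Rate function.** A non-decreasing $\rho\colon\mathbb{R}_{\ge0}\to\mathbb{R}_{\ge0}$ with $\rho(\varepsilon)\to0$ as $\varepsilon\to0$. **Graphs.** A graph $\mathcal{G}$ consists of a set $V(\mathcal{G})$ of vertices, a set $\overrightarrow{E}(\mathcal{G})$ of directed edges, maps $\iota,\tau\colon\overrightarrow{E}(\mathcal{G})\to V(\mathcal{G})$ (origin, terminus) and a fixed-point-free involution $e\mapsto\bar e$ of $\overrightarrow{E}(\mathcal{G})$ with $\tau(\bar e)=\iota(e)$. Loops and multiple edges are allowed. Write $[e]=\{e,\bar e\}$ and $E(\mathcal{G})=\{[e]\}$ for the set of unoriented edges. A path $\pi=e_1\cdots e_\ell$ is a sequence of directed edges with $\tau(e_i)=\iota(e_{i+1})$; it starts at $\iota(e_1)$, ends at $\tau(e_\ell)$, and is closed if these agree (otherwise open). It is non-backtracking if $e_{i+1}\ne\bar e_i$ for all $1\le i\le \ell-1$. The orientations of a closed path $e_1\cdots e_\ell$ are its cyclic shifts $e_k\cdots e_\ell e_1\cdots e_{k-1}$ and their reverses $\bar e_{k-1}\cdots\bar e_1\bar e_\ell\cdots\bar e_k$; the set of all of them is denoted $[\pi]$. A closed path is cyclically reduced if all its orientations are non-backtracking.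 A combinatorial map $f\colon\mathcal{G}\to\mathcal{H}$ of graphs maps vertices to vertices and directed edges to directed edges, commuting with $\iota,\tau$ and $\bar{\ }$; it extends to paths edge by edge. **Polygonal complexes.** A polygonal complex $\mathcal{X}$ is a graph $G(\mathcal{X})$ together with a set $\overrightarrow{P}(\mathcal{X})$ of cyclically reduced closed paths (of positive length) in it, called oriented polygons, closed under passing to orientations. $P(\mathcal{X})=\{[\pi]\}$ is the set of unoriented polygons. Write $V(\mathcal{X}),\overrightarrow{E}(\mathcal{X}),E(\mathcal{X})$ for the data of $G(\mathcal{X})$. $\mathcal{X}$ is finite if all these sets are finite, and connected if $G(\mathcal X)$ is connected. Expectations are with respect to uniform distributions; an average over an empty set is taken to be $0$. **Distance of permutations.** $\mathrm{Sym}(n)$ acts on the left on $[n]=\{1,\dots,n\}$. For $\sigma\in\mathrm{Sym}(n),\tau\in\mathrm{Sym}(N)$, $$d_h(\sigma,\tau)=1-\frac{|\{i\le\min(n,N):\sigma(i)=\tau(i)\}|}{\max(n,N)}.$$ **Cocycle stability.** A $1$-cochain is a map $\alpha\colon\overrightarrow{E}(\mathcal{X})\to\mathrm{Sym}(n)$ (some $n\geq 2$) with $\alpha(\bar e)=\alpha(e)^{-1}$. For a polygon $\pi=e_1\cdots e_\ell$ put $\delta\alpha(\pi)=\alpha(e_1)\cdots\alpha(e_\ell)$. $\alpha$ is a $1$-cocycle if $\delta\alpha(\pi)=\mathrm{Id}$ for all $\pi\in\overrightarrow{P}(\mathcal{X})$. The distance of $\alpha,\beta$ (with possibly different $n,N$)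 is $d_h(\alpha,\beta)=\mathbb{E}_{[e]\in E(\mathcal{X})}[d_h(\alpha(e),\beta(e))]$. Put $\mathrm{def}_{cocyc}(\alpha)=\mathbb{E}_{[\pi]\in P(\mathcal{X})}[d_h(\delta\alpha(\pi),\mathrm{Id})]$ (independent of the chosen representatives $\pi$) and $\mathrm{Def}_{cocyc}(\alpha)=\inf\{d_h(\alpha,\varphi)\mid \varphi \text{ a } 1\text{-cocycle with values in some }\mathrm{Sym}(N)\}$. $\mathcal{X}$ is $\rho$-cocycle stable if $\mathrm{Def}_{cocyc}(\alpha)\le\rho(\mathrm{def}_{cocyc}(\alpha))$ for every $1$-cochain $\alpha$ (for every $n$). **Covering stability.** A combinatorial map of graphs $f\colon\mathcal{G}\to G(\mathcal{X})$ is a covering if for each vertex $y$ of $\mathcal{G}$ it maps $\{e\mid\tau(e)=y\}$ bijectively onto $\{e\mid\tau(e)=f(y)\}$ (equivalently, it is a topological covering of the geometric realizations); it has degree $n$ if every vertex fiber has $n$ elements. All coverings here have finite degree $n\ge1$. For a path $\pi$ in $G(\mathcal{X})$ starting at $x$ and $x'\in f^{-1}(x)$ there is a unique lift of $\pi$ to $x'$: a path $\pi'$ in $\mathcal{G}$ starting at $x'$ with $f(\pi')=\pi$. $f$ is a genuine covering of $\mathcal{X}$ if polygons can be glued to $\mathcal{G}$ so that $f$ extends to a topological covering of $\mathcal{X}$; equivalently (take this as the definition), every lift of every polygon $\pi\in\overrightarrow{P}(\mathcal{X})$ is a closed path. The covering local defect $\mathrm{def}_{cover}(f)$ is the probability that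 the lift of $\pi$ to $x'$ is open, where $[\pi]\in P(\mathcal{X})$ is uniform, $\pi$ is a uniform representative of $[\pi]$ with starting vertex $x$, and $x'\in f^{-1}(x)$ is uniform. A $G(\mathcal{X})$-labeled graph is a graph $\mathcal{G}$ with a combinatorial map to $G(\mathcal{X})$; morphisms are combinatorial maps commuting with the labelings, and embeddings are injective morphisms. For finite $G(\mathcal{X})$-labeled graphs $\mathcal{G},\mathcal{Y}$ let $\mathcal{A}$ be a $G(\mathcal{X})$-labeled graph embedding into both with the maximal number of edges, and put $$d_{edit}(\mathcal{G},\mathcal{Y})=1-\frac{|E(\mathcal{A})|}{\max(|E(\mathcal{G})|,|E(\mathcal{Y})|)}$$ ($0$ if there are no edges). The covering global defect $\mathrm{Def}_{cover}(f)$ is the infimum of $d_{edit}(\mathcal{G},\mathcal{Y})$ over all genuine coverings $\varphi\colon\mathcal{Y}\to G(\mathcal{X})$ of $\mathcal{X}$, with labelings $f$ and $\varphi$. $\mathcal{X}$ is $\rho$-covering stable if $\mathrm{Def}_{cover}(f)\le\rho(\mathrm{def}_{cover}(f))$ for every covering $f\colon\mathcal{G}\to G(\mathcal{X})$. *)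

(* Defs.v *)
(* MathComp / MathComp-Analysis *)
From HB Require Import structures.
From mathcomp Require Import all_boot all_order all_algebra all_fingroup.
From mathcomp Require Import finmap.
From mathcomp Require Import all_classical all_reals all_analysis.

Set Implicit Arguments.
Unset Strict Implicit.
Unset Printing Implicit Defensive.

Import Order.TTheory GRing.Theory Num.Theory.
Import numFieldNormedType.Exports.

Local Open Scope classical_set_scope.
Local Open Scope fset_scope.
Local Open Scope ring_scope.

(* Only the values on [0, +oo[ matter. *)
Definition rate_function (R : realType) (rho : R -> R) : Prop :=
  [/\ forall x, 0 <= x -> 0 <= rho x,
      forall x y, 0 <= x -> x <= y -> rho x <= rho y &
      rho x @[x --> 0^'+] --> (0 : R)].

(* Expectation for the uniform distribution on the entries of a duplicate-free
   sequence; it is 0 for the empty sequence because 0^-1 = 0. *)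
Definition avg (R : realType) (T : Type) (s : seq T) (F : T -> R) : R :=
  (\sum_(x <- s) F x) / (size s)%:R.

(* Graphs with finitely many vertices and edges. A covering of finite degree of
   a finite graph is finite, so no other graph is needed. *)
Record graph := Graph {
  vertex : finType;
  dart : finType; (* directed edges *)
  org : dart -> vertex;
  trm : dart -> vertex;
  bar : dart -> dart;
  barK : forall e, bar (bar e) = e;
  bar_neq : forall e, bar e != e;
  trm_bar : forall e, trm (bar e) = org e }.

Arguments org {g}.
Arguments trm {g}.
Arguments bar {g}.

Definition uedge (G : graph) (e : dart G) : {fset dart G} := [fset e; bar e].

Definition uedges (G : graph) : {fset {fset dart G}} :=
  [fset uedge e | e in enum (dart G)].

Definition is_path (G : graph) (p : seq (dart G)) : bool :=
  sorted (fun e e' => trm e == org e') p.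

(* The value None occurs only for the empty sequence. *)
Definition source (G : graph) (p : seq (dart G)) : option (vertex G) :=
  ohead (map org p).

Definition target (G : graph) (p : seq (dart G)) : option (vertex G) :=
  ohead (rev (map trm p)).

Definition closed_path (G : graph) (p : seq (dart G)) : bool :=
  is_path p && (source p == target p).

Definition non_backtracking (G : graph) (p : seq (dart G)) : bool :=
  sorted (fun e e' => e' != bar e) p.

Definition orientations (G : graph) (p : seq (dart G)) :
    {fset seq (dart G)} :=
  [fset rot k p | k in iota 0 (size p)] `|`
  [fset map bar (rev (rot k p)) | k in iota 0 (size p)].

Definition cyclically_reduced (G : graph) (p : seq (dart G)) : bool :=
  all (@non_backtracking G) (orientations p).

Definition graph_connected (G : graph) : Prop :=
  forall x y : vertex G,
    connect (fun u v => [exists e : dart G, (org e == u) && (trm e == v)]) x y.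

Record gmap (G H : graph) := Gmap {
  vmap : vertex G -> vertex H;
  emap : dart G -> dart H;
  org_emap : forall e, org (emap e) = vmap (org e);
  trm_emap : forall e, trm (emap e) = vmap (trm e);
  bar_emap : forall e, emap (bar e) = bar (emap e) }.

Record polygonal_complex := PolygonalComplex {
  skeleton :> graph;
  polygons : {fset seq (dart skeleton)}; (* oriented polygons *)
  polygonP : forall p, p \in polygons ->
    [&& (0 < size p)%N, closed_path p & cyclically_reduced p];
  polygon_orientations : forall p q, p \in polygons ->
    q \in orientations p -> q \in polygons }.

Definition upolygons (X : polygonal_complex) : {fset {fset seq (dart X)}} :=
  [fset orientations p | p in polygons X].

(* {1, ..., n} is encoded as {0, ..., n - 1}. *)
Definition dh (R : realType) (n N : nat) (s : 'S_n) (t : 'S_N) : R :=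
  1 - #|[pred i : 'I_(minn n N) |
          (s (widen_ord (geq_minl n N) i) : nat)
          == t (widen_ord (geq_minr n N) i)]|%:R / (maxn n N)%:R.

Definition cochain (X : polygonal_complex) (n : nat)
    (alpha : dart X -> 'S_n) : Prop :=
  (2 <= n)%N /\ forall e, alpha (bar e) = ((alpha e)^-1)%g.

(* alpha e_1 o ... o alpha e_l: the product of the library composes permutations
   from left to right, (s * t) i = t (s i), hence the reversal. *)
Definition delta (X : polygonal_complex) (n : nat) (alpha : dart X -> 'S_n)
    (p : seq (dart X)) : 'S_n :=
  (\prod_(e <- rev p) alpha e)%g.

Definition cocycle (X : polygonal_complex) (n : nat)
    (alpha : dart X -> 'S_n) : Prop :=
  cochain alpha /\ forall p, p \in polygons X -> delta alpha p = 1%g.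

(* In the next two definitions the summand takes the same value on all
   representatives of a class when alpha and beta are cochains; averaging over
   the class c picks that common value. *)
Definition cochain_dist (R : realType) (X : polygonal_complex) (n N : nat)
    (alpha : dart X -> 'S_n) (beta : dart X -> 'S_N) : R :=
  avg (uedges X) (fun c => avg c (fun e => dh R (alpha e) (beta e))).

Definition def_cocyc (R : realType) (X : polygonal_complex) (n : nat)
    (alpha : dart X -> 'S_n) : R :=
  avg (upolygons X) (fun c =>
    avg c (fun p => dh R (delta alpha p) (1%g : 'S_n))).

Definition Def_cocyc (R : realType) (X : polygonal_complex) (n : nat)
    (alpha : dart X -> 'S_n) : R :=
  inf [set d : R | exists (N : nat) (phi : dart X -> 'S_N),
         cocycle phi /\ d = cochain_dist R alpha phi].

Definition cocycle_stable (R : realType) (X : polygonal_complex)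
    (rho : R -> R) : Prop :=
  forall (n : nat) (alpha : dart X -> 'S_n), cochain alpha ->
    Def_cocyc R alpha <= rho (def_cocyc R alpha).

Definition star (G : graph) (y : vertex G) : {set dart G} :=
  [set e | trm e == y].

Definition covering (G H : graph) (f : gmap G H) : Prop :=
  (forall y : vertex G, {in star y &, injective (emap f)} /\
                        (emap f @: star y)%SET = star (vmap f y)) /\
  (exists n : nat, (1 <= n)%N /\
     forall x : vertex H, #|[pred y | vmap f y == x]| = n).

Definition lift (G H : graph) (f : gmap G H) (p : seq (dart H))
    (p' : seq (dart G)) : Prop :=
  is_path p' /\ map (emap f) p' = p.

Definition genuine_covering (X : polygonal_complex) (Y : graph)
    (f : gmap Y X) : Prop :=
  covering f /\
  forall p p', p \in polygons X -> lift f p p' -> closed_path p'.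

Definition lift_open (G H : graph) (f : gmap G H) (p : seq (dart H))
    (x' : vertex G) : bool :=
  `[< exists p', [/\ lift f p p', source p' = Some x' & ~~ closed_path p'] >].

Definition def_cover (R : realType) (X : polygonal_complex) (G : graph)
    (f : gmap G X) : R :=
  avg (upolygons X) (fun c =>
    avg c (fun p =>
      avg (enum [pred x' | Some (vmap f x') == source p]) (fun x' =>
        (lift_open f p x')%:R))).

(* A graph A labeled by a embeds into the graph G labeled by g. *)
Definition embeds (L A G : graph) (a : gmap A L) (g : gmap G L) : Prop :=
  exists h : gmap A G,
    [/\ forall v, vmap g (vmap h v) = vmap a v,
        forall e, emap g (emap h e) = emap a e,
        injective (vmap h) & injective (emap h)].

(* Maximal number of edges of a common labeled subgraph; the bound on m loses
   nothing, as a graph embedding into G has at most as many edges as G. *)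
Definition max_common_edges (L G Y : graph) (g : gmap G L) (y : gmap Y L) :
    nat :=
  \max_(m < #|` uedges G|.+1 |
        `[< exists (A : graph) (a : gmap A L),
              [/\ embeds a g, embeds a y & #|` uedges A| = m] >]) (m : nat).

Definition d_edit (R : realType) (L G Y : graph) (g : gmap G L)
    (y : gmap Y L) : R :=
  let M := maxn #|` uedges G| #|` uedges Y| in
  if M == 0%N then 0 else 1 - (max_common_edges g y)%:R / M%:R.

Definition Def_cover (R : realType) (X : polygonal_complex) (G : graph)
    (f : gmap G X) : R :=
  inf [set d : R | exists (Y : graph) (phi : gmap Y X),
         genuine_covering phi /\ d = d_edit R f phi].

Definition covering_stable (R : realType) (X : polygonal_complex)
    (rho : R -> R) : Prop :=
  forall (G : graph) (f : gmap G X), covering f ->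
    Def_cover R f <= rho (def_cover R f).

(* Main.v *)
Require Import Defs.
From mathcomp Require Import all_boot all_order all_algebra all_reals.
From mathcomp Require Import all_fingroup finmap boolp classical_sets.

Set Implicit Arguments.
Unset Strict Implicit.
Unset Printing Implicit Defensive.

Import Order.TTheory GRing.Theory Num.Theory.

Local Open Scope ring_scope.

(** A cochain [alpha] with values in ['S_n] is the monodromy of a covering of
    degree [n]: take [n] copies of every vertex and of every directed edge, and
    let the copy [i] of [e] end at the copy [i] of [trm e] and start at the copy
    [alpha e i] of [org e]. Conversely, numbering the fibres of a covering and
    reading off how its directed edges permute the numbers gives a cochain
    ([covering_trivialization]). The two stability properties correspond to each
    other under this dictionary because both defects do.

    Local defects are equal ([def_cover_trivialized]). Following [alpha] along a
    closed path [p] shows that the lifts of [p] that close up are those that end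
    at a fixed point of [delta alpha p]. For the same reason genuine coverings
    correspond to cocycles ([genuine_delta]).

    Global defects are compared one competitor at a time. A cocycle [phi] gives
    a genuine covering, and every agreement [alpha e i = phi e i] gives a
    directed edge common to the two coverings; both distances count what is not
    common, so the edit distance is at most the distance of cochains
    ([Def_cover_le_cochain_dist]). In the other direction, a common subgraph of
    two coverings need not respect the numbers of the fibres. Since the distance
    of cochains depends on the numbering while [alpha] is given, the fibres of
    the genuine covering are renumbered so that the common subgraph joins points
    with equal numbers. This is possible once its degree [N] is at least [n], and
    when [N < n] it may be enlarged by [n - N] copies of [X], which keeps it
    genuine and leaves the maximum of the two degrees, hence the denominator of
    the distance, unchanged ([cocycle_of_common_subgraph]). *)

(** * Permutations *)

(** A finite partial injection extends to a permutation. In the induction, if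
    [s] is right on [r], then composing it with the transposition of [s (p a)]
    and [q a] makes it right at [a]; the values on [r] survive because they are
    different from both points. *)
Lemma perm_extends (A : eqType) (T : finType) (p q : A -> T) (r : seq A) :
    {in r &, injective p} -> {in r &, injective q} ->
  exists s : {perm T}, forall a, a \in r -> s (p a) = q a.
Proof.
elim: r => [|a r IHr] p_inj q_inj; first by exists 1%g.
have sub_r : {subset r <= a :: r} by move=> b; rewrite inE orbC => ->.
have [s sE] : exists s : {perm T}, forall b, b \in r -> s (p b) = q b.
  by apply: IHr => b c /sub_r bP /sub_r cP; [apply: p_inj | apply: q_inj].
have [a_r | a_notin_r] := boolP (a \in r).
  by exists s => b; rewrite inE => /predU1P[-> | ]; apply: sE.
exists (s * tperm (s (p a)) (q a))%g => b.
rewrite inE permM => /predU1P[-> | b_r]; first by rewrite tpermL.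
rewrite (sE b) // tpermD //; apply: contraNneq a_notin_r.
  rewrite -(sE b) // => /perm_inj/p_inj -> //; first by rewrite mem_head.
  exact: sub_r.
move/q_inj => -> //; first by rewrite mem_head.
exact: sub_r.
Qed.

Definition pad_fun N k (s : 'S_N) (i : 'I_(N + k)) : 'I_(N + k) :=
  match split i with inl j => lshift k (s j) | inr _ => i end.

Lemma pad_funK N k (s t : 'S_N) (i : 'I_(N + k)) :
  pad_fun t (pad_fun s i) = pad_fun (s * t)%g i.
Proof.
rewrite {2 3}/pad_fun; case E: (split i) => [j|j].
  by rewrite /pad_fun -/(unsplit (inl (s j))) unsplitK permM.
by rewrite /pad_fun E.
Qed.

Lemma pad_fun1 N k (i : 'I_(N + k)) : pad_fun (1%g : 'S_N) i = i.
Proof.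
rewrite /pad_fun; case E: (split i) => [j|//]; rewrite perm1.
by rewrite -[RHS]splitK E.
Qed.

Lemma pad_fun_inj N k (s : 'S_N) : injective (@pad_fun N k s).
Proof.
by apply: (can_inj (g := pad_fun s^-1%g)) => i; rewrite pad_funK mulgV pad_fun1.
Qed.

(** The action on a fibre to which [k] trivial sheets have been added. *)
Definition pad N k (s : 'S_N) : 'S_(N + k) := perm (@pad_fun_inj N k s).

Lemma padM N k (s t : 'S_N) : pad k (s * t)%g = (pad k s * pad k t)%g.
Proof. by apply/permP => i; rewrite permM !permE pad_funK. Qed.

Lemma pad1 N k : pad k (1%g : 'S_N) = 1%g.
Proof. by apply/permP => i; rewrite perm1 permE pad_fun1. Qed.

Lemma padV N k (s : 'S_N) : pad k (s^-1)%g = ((pad k s)^-1)%g.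
Proof. by apply/eqP; rewrite eq_sym eq_invg_mul -padM mulgV pad1. Qed.

Lemma pad_lshift N k (s : 'S_N) (i : 'I_N) :
  pad k s (lshift k i) = lshift k (s i).
Proof. by rewrite permE /pad_fun -/(unsplit (inl i)) unsplitK. Qed.

(** * Averages *)

Lemma avg_eq (R : realType) (T : eqType) (s : seq T) (F G : T -> R) :
  {in s, F =1 G} -> avg s F = avg s G.
Proof. by move=> FG; rewrite /avg (eq_big_seq _ FG). Qed.

Lemma avg_ge0 (R : realType) (T : Type) (s : seq T) (F : T -> R) :
  (forall x, 0 <= F x) -> 0 <= avg s F.
Proof. by move=> F0; rewrite /avg divr_ge0 ?ler0n ?sumr_ge0. Qed.

Lemma big_uedges (R : Type) (idx : R) (op : Monoid.com_law idx) (G : graph)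
    (F : dart G -> R) :
  \big[op/idx]_(c <- uedges G) \big[op/idx]_(e <- c) F e = \big[op/idx]_e F e.
Proof.
have enumE :
    perm_eq (index_enum (dart G)) [fset e | e in enum (dart G)]%fset.
  apply: uniq_perm; rewrite ?fset_uniq ?index_enum_uniq // => e.
  by rewrite mem_index_enum !inE mem_enum.
have uedgesE : uedges G =
    [fset uedge e | e in [fset e | e in enum (dart G)]]%fset.
  apply/fsetP => c; apply/imfsetP/imfsetP => -[e e_in ->]; exists e => //;
  by rewrite /= ?inE /= mem_enum.
rewrite (perm_big _ enumE) (partition_big_imfset _ (@uedge G)) -uedgesE.
apply: eq_big_seq => _ /imfsetP[/= e0 _ ->].
rewrite -[RHS]big_filter; apply: perm_big; apply: uniq_perm.
- exact: fset_uniq.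
- by rewrite filter_uniq ?fset_uniq.
move=> e; rewrite mem_filter !inE mem_enum andbT.
apply/idP/eqP => [/orP[] /eqP-> // | ue].
  by apply/fsetP => d; rewrite /uedge !inE barK orbC.
have : e \in uedge e by rewrite !inE eqxx.
by rewrite ue !inE.
Qed.

Lemma size_uedge (G : graph) (c : {fset dart G}) :
  c \in uedges G -> size c = 2.
Proof.
by case/imfsetP => /= e _ ->; rewrite /uedge cardfs2 eq_sym bar_neq.
Qed.

Lemma card_uedges (G : graph) : (#|` uedges G| * 2 = #|dart G|)%N.
Proof.
rewrite -sum1_card -big_uedges -sum1_size big_distrl /=.
by apply: eq_big_seq => c c_in; rewrite sum1_size size_uedge.
Qed.

(** Every class consists of two directed edges, so averaging over the classes is
    averaging over the directed edges. *)
Lemma avg_uedges (R : realType) (G : graph) (F : dart G -> R) :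
  avg (uedges G) (fun c => avg c F) = (\sum_e F e) / #|dart G|%:R.
Proof.
rewrite -card_uedges natrM invfM mulrCA mulrC /avg; congr (_ * _).
rewrite -big_uedges mulr_suml; apply: eq_big_seq => c c_in.
by rewrite size_uedge.
Qed.

(** * The distance of permutations *)

(** A set of numbers below [n], not below [minn n N], so that [s] applies to its
    elements without a cast; [dhE] shows that the count is the same. *)
Definition agreements n N (s : 'S_n) (t : 'S_N) : {set 'I_n} :=
  [set i : 'I_n | [exists j : 'I_N, (j == i :> nat) && (t j == s i :> nat)]].

Lemma dhE (R : realType) n N (s : 'S_n) (t : 'S_N) :
  dh R s t = 1 - #|agreements s t|%:R / (maxn n N)%:R.
Proof.
rewrite /dh; congr (1 - _%:R / _).
rewrite -(card_imset _ (f := widen_ord (geq_minl n N))); last first.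
  by move=> i j /(congr1 val)/= /val_inj.
apply: eq_card => i; rewrite inE.
apply/imsetP/existsP => [[k]|[j /andP[ij tj]]].
  rewrite inE => /eqP st ->.
  by exists (widen_ord (geq_minr n N) k); rewrite /= st !eqxx.
have lt_i : (i < minn n N)%N by rewrite leq_min ltn_ord -(eqP ij) ltn_ord.
exists (Ordinal lt_i); last exact: val_inj.
rewrite inE; apply/eqP; rewrite [RHS](_ : _ = t j :> nat); last first.
  by congr (nat_of_ord (t _)); apply: val_inj; rewrite /= (eqP ij).
by rewrite (eqP tj); congr (nat_of_ord (s _)); apply: val_inj.
Qed.

Lemma card_agreements_le n N (s : 'S_n) (t : 'S_N) :
  (#|agreements s t| <= maxn n N)%N.
Proof. by rewrite (leq_trans (max_card _)) // card_ord leq_maxl. Qed.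

Lemma dh_ge0 (R : realType) n N (s : 'S_n) (t : 'S_N) : 0 <= dh R s t.
Proof.
rewrite dhE subr_ge0; have := card_agreements_le s t.
case: (maxn n N) => [|m] le_m; first by rewrite invr0 mulr0 ler01.
by rewrite ler_pdivrMr ?ltr0n // mul1r ler_nat.
Qed.

Lemma dh_same (R : realType) n (s t : 'S_n) : (0 < n)%N ->
  dh R s t = (\sum_i (s i != t i)%:R) / n%:R.
Proof.
move=> n_gt0; have nR0 : n%:R != 0 :> R by rewrite pnatr_eq0 -lt0n.
rewrite dhE maxnn -{1}(divff nR0) -mulrBl; congr (_ / _).
have -> : agreements s t = [set i | s i == t i].
  apply/setP => i; rewrite !inE; apply/existsP/eqP => [[j /andP[/eqP ji]]|st].
    by move=> /eqP/val_inj <-; congr (t _); apply: val_inj.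
  by exists i; rewrite st !eqxx.
apply/eqP; rewrite subr_eq -natr_sum -natrD eqr_nat.
have -> : (\sum_i (s i != t i))%N = #|~: [set i | s i == t i]|.
  rewrite -sum1_card [RHS]big_mkcond; apply: eq_bigr => i _.
  by rewrite !inE; case: eqP.
by rewrite addnC cardsC card_ord.
Qed.

(** * Trivializations of coverings *)

Lemma org_bar (G : graph) (e : dart G) : org (bar e) = trm e.
Proof. by rewrite -trm_bar barK. Qed.

(** The graph with vertices [vertex X * 'I_n] and directed edges
    [dart X * 'I_n], in which [(e, i)] runs from [(org e, alpha e i)] to
    [(trm e, i)], covers [X]. A trivialization of [f] is an isomorphism over [X]
    with this covering: [nu] numbers the points of each fibre, and [alpha] is
    the monodromy read off in this numbering. *)
Record trivialization (X G : graph) (f : gmap G X) (n : nat)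
    (alpha : dart X -> 'S_n) (nu : vertex G -> 'I_n) : Prop := Trivialization {
  triv_vertex : bijective (fun v => (vmap f v, nu v));
  triv_dart : bijective (fun d => (emap f d, nu (trm d)));
  triv_org : forall d, nu (org d) = alpha (emap f d) (nu (trm d)) }.

Section Trivialization.

Variables (X G : graph) (f : gmap G X) (n : nat).
Variables (alpha : dart X -> 'S_n) (nu : vertex G -> 'I_n).
Hypothesis f_triv : trivialization f alpha nu.

Lemma triv_vertex_inj v w : vmap f v = vmap f w -> nu v = nu w -> v = w.
Proof.
move=> fvw nvw; apply: (bij_inj (triv_vertex f_triv)).
by rewrite fvw nvw.
Qed.

Lemma triv_dart_inj d e : emap f d = emap f e -> trm d = trm e -> d = e.
Proof.
move=> fde tde; apply: (bij_inj (triv_dart f_triv)).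
by rewrite fde tde.
Qed.

Lemma triv_vertex_over x i : exists2 v, vmap f v = x & nu v = i.
Proof.
have [g _ gK] := triv_vertex f_triv; have [fv nv] := gK (x, i).
by exists (g (x, i)).
Qed.

Lemma triv_dart_over e v : vmap f v = trm e ->
  exists2 d, emap f d = e & trm d = v.
Proof.
have [g _ gK] := triv_dart f_triv => fv; have [fd nd] := gK (e, nu v).
by exists (g (e, nu v)) => //; apply: triv_vertex_inj; rewrite // -trm_emap fd.
Qed.

Lemma triv_bar e : alpha (bar e) = ((alpha e)^-1)%g.
Proof.
apply/permP => i; have [v fv <-] := triv_vertex_over (org e) i.
have [|d fd <-] := @triv_dart_over (bar e) v; first by rewrite trm_bar.
have := triv_org f_triv (bar d).
rewrite org_bar trm_bar bar_emap fd barK -fd -(triv_org f_triv) => ->.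
by rewrite permK.
Qed.

Lemma card_triv_dart : #|dart G| = (n * #|dart X|)%N.
Proof.
by rewrite (bij_eq_card (triv_dart f_triv)) card_prod card_ord mulnC.
Qed.

Lemma card_triv_fibre x : #|[pred v | vmap f v == x]| = n.
Proof.
rewrite -[RHS]card_ord -(card_in_imset (f := nu)); last first.
  move=> v w; rewrite !inE => /eqP fv /eqP fw; apply: triv_vertex_inj.
  by rewrite fv.
apply: eq_card => i; rewrite [RHS]inE; apply/imsetP.
by have [v fv <-] := triv_vertex_over x i; exists v; rewrite ?inE ?fv.
Qed.

Lemma triv_covering : (0 < n)%N -> covering f.
Proof.
move=> n_gt0; split=> [y | ]; last first.
  by exists n; split=> //; apply: card_triv_fibre.
split=> [d e | ].
  rewrite !inE => /eqP td /eqP te fde; apply: triv_dart_inj => //.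
  by rewrite td.
apply/setP => e; rewrite inE; apply/imsetP/eqP => [[d] | te].
  by rewrite inE => /eqP <- ->; rewrite trm_emap.
have [|d <- td] := @triv_dart_over e y; first by rewrite te.
by exists d; rewrite ?inE ?td.
Qed.

End Trivialization.

(** Numbering the fibres of a covering and reading off the monodromy turns every
    covering into a trivialized one. *)
Lemma covering_trivialization (X G : graph) (f : gmap G X) : covering f ->
  exists n (alpha : dart X -> 'S_n) (nu : vertex G -> 'I_n),
    (0 < n)%N /\ trivialization f alpha nu.
Proof.
case=> f_star [[|m] [//= _ f_fibre]].
pose fibre x := enum [pred v | vmap f v == x].
pose nu v : 'I_m.+1 := inord (index v (fibre (vmap f v))).
have size_fibre x : size (fibre x) = m.+1 by rewrite -cardE f_fibre.
have mem_fibre v : v \in fibre (vmap f v) by rewrite mem_enum inE.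
have nu_inj v w : vmap f v = vmap f w -> nu v = nu w -> v = w.
  move=> fvw /(congr1 val); rewrite /= !inordK ?[X in (_ < X)%N]/=; first last.
  - by rewrite -(size_fibre (vmap f v)) index_mem.
  - by rewrite -(size_fibre (vmap f w)) index_mem.
  have v_fibre : v \in fibre (vmap f w) by rewrite -fvw.
  by rewrite fvw => /(congr1 (nth v (fibre (vmap f w)))); rewrite !nth_index.
have vertex_bij : bijective (fun v => (vmap f v, nu v)).
  apply: inj_card_bij => [v w [] | ]; first exact: nu_inj.
  rewrite card_prod card_ord mulnC -[in leqRHS]sum1_card.
  rewrite (partition_big (vmap f) predT) //= mulnC -sum_nat_const.
  by apply: leq_sum => x _; rewrite sum1_card f_fibre.
have dart_inj d e : emap f d = emap f e -> trm d = trm e -> d = e.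
  move=> fde tde; have [inj_star _] := f_star (trm d).
  by apply: inj_star; rewrite ?inE ?tde.
have dart_bij : bijective (fun d => (emap f d, nu (trm d))).
  have [vtx _ vtxK] := vertex_bij.
  have dartP (ei : dart X * 'I_m.+1) :
      exists d, (emap f d == ei.1) && (trm d == vtx (trm ei.1, ei.2)).
    have [_ star_eq] := f_star (vtx (trm ei.1, ei.2)).
    have [fv _] := vtxK (trm ei.1, ei.2).
    have : ei.1 \in star (vmap f (vtx (trm ei.1, ei.2))).
      by rewrite inE fv.
    rewrite -star_eq => /imsetP[d]; rewrite inE => td ei1.
    by exists d; rewrite td andbT -ei1.
  exists (fun ei => xchoose (dartP ei)) => [d | ei].
    have /andP[/eqP fd /eqP td] := xchooseP (dartP (emap f d, nu (trm d))).
    apply: dart_inj => //; rewrite td /=.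
    have [fv nv] := vtxK (trm (emap f d), nu (trm d)).
    by apply: nu_inj; rewrite ?fv ?nv ?trm_emap.
  have /andP[/eqP fd /eqP td] := xchooseP (dartP ei).
  have [_ nv] := vtxK (trm ei.1, ei.2).
  by rewrite fd td nv -surjective_pairing.
have [drt drtK Kdrt] := dart_bij.
have org_inj e : injective (fun i => nu (org (drt (e, i)))).
  move=> i j /= nij.
  have [fi ni] := Kdrt (e, i); have [fj nj] := Kdrt (e, j).
  rewrite -ni -nj; congr (nu (trm _)).
  rewrite -[LHS]barK -[RHS]barK; congr bar; apply: dart_inj.
    by rewrite !bar_emap fi fj.
  by rewrite !trm_bar; apply: nu_inj; rewrite // -!org_emap fi fj.
exists m.+1, (fun e => perm (@org_inj e)), nu; split=> //; split=> // d.
by rewrite permE drtK.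
Qed.

(** * Lifting paths *)

Lemma delta_cons (X : polygonal_complex) n (alpha : dart X -> 'S_n) e p :
  delta alpha (e :: p) = (delta alpha p * alpha e)%g.
Proof. by rewrite /delta rev_cons -cats1 big_cat big_seq1. Qed.

Lemma target_cons (G : graph) (e : dart G) (q : seq (dart G)) :
  target (e :: q) = Some (last (trm e) (map trm q)).
Proof. by rewrite /target /= lastI rev_rcons. Qed.

Section Lifting.

Variables (X : polygonal_complex) (G : graph) (f : gmap G X) (n : nat).
Variables (alpha : dart X -> 'S_n) (nu : vertex G -> 'I_n).
Hypothesis f_triv : trivialization f alpha nu.

Lemma delta_lift e q : is_path (e :: q) ->
  nu (org e) =
  delta alpha (map (emap f) (e :: q)) (nu (last (trm e) (map trm q))).
Proof.
elim: q e => [|e' q IHq] e /=.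
  by rewrite delta_cons /delta big_nil mul1g (triv_org f_triv).
case/andP=> /eqP te /IHq nu_e'.
by rewrite delta_cons permM -nu_e' -te -triv_org.
Qed.

Lemma lift_exists e q v : is_path (e :: q) ->
    vmap f v = last (trm e) (map trm q) ->
  exists d r, Defs.lift f (e :: q) (d :: r) /\ last (trm d) (map trm r) = v.
Proof.
elim: q e => [|e' q IHq] e /=.
  by move=> _ /(triv_dart_over f_triv)[d <- <-]; exists d, [::].
case/andP=> /eqP te /IHq IH /IH[d' [r [[path_r [fd' fr]] last_r]]].
have [|d fd td] := @triv_dart_over _ _ _ _ _ _ f_triv e (org d').
  by rewrite -org_emap fd'.
exists d, (d' :: r); split=> //; split; last by rewrite /= fd fd' fr.
by rewrite /is_path /= td eqxx.
Qed.

Lemma vmap_last d r :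
  vmap f (last (trm d) (map trm r)) =
  last (trm (emap f d)) (map trm (map (emap f) r)).
Proof.
by rewrite !last_map trm_emap.
Qed.

(** A closed path [p] has, over each number [i] of its base point, one lift that
    ends there; by [delta_lift] this lift starts at the number [delta alpha p i].
    So the closed lifts belong to the fixed points of [delta alpha p]. *)
Lemma lift_openE p x' : closed_path p -> Some (vmap f x') = source p ->
  lift_open f p x' = (delta alpha p (nu x') != nu x').
Proof.
case: p => [|e q]; first by [].
case/andP=> path_p; rewrite target_cons /= => /eqP[org_e] [fx'].
apply/asboolP/idP => [[[|d r] []] | moved].
- by case.
- case=> path_r fr [org_d]; apply: contraNN => /eqP fix_x'.
  rewrite /closed_path path_r target_cons /=; apply/eqP; congr Some.
  have := delta_lift path_r; rewrite fr org_d -[LHS]fix_x' => /perm_inj.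
  apply: (triv_vertex_inj f_triv); case: fr => fd fq.
  by rewrite vmap_last fd fq fx'.
have [v fv nu_v] :=
  triv_vertex_over f_triv (org e) ((delta alpha (e :: q))^-1%g (nu x')).
have [|d [r [[path_r fr] last_r]]] := @lift_exists e q v path_p.
  by rewrite fv org_e.
have org_d : org d = x'.
  apply: (triv_vertex_inj f_triv).
    by case: fr => fd _; rewrite -org_emap fd fx'.
  by rewrite (delta_lift path_r) fr last_r nu_v permKV.
exists (d :: r); split; [by split | by rewrite /source /= org_d | ].
rewrite /closed_path path_r target_cons last_r /source /= org_d.
apply: contraNN moved => /eqP[x'v].
by rewrite x'v {1}nu_v permKV x'v.
Qed.

Lemma genuine_delta :
  (forall p p', p \in polygons X -> Defs.lift f p p' -> closed_path p') <->
  (forall p, p \in polygons X -> delta alpha p = 1%g).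
Proof.
split=> [closed_lift | flat] p.
  move=> p_in; have /and3P[p_gt0 p_closed _] := polygonP p_in.
  apply/permP => i; rewrite perm1; case: p p_in p_gt0 p_closed => // e q.
  move=> p_in _ p_closed.
  have [v fv nu_v] := triv_vertex_over f_triv (org e) i.
  apply/eqP; rewrite -nu_v -[_ == _]negbK -lift_openE //= ?fv //.
  apply/asboolP => -[p' [lift_p' _]].
  by rewrite (closed_lift _ _ p_in lift_p').
move=> p' p_in lift_p'; have /and3P[p_gt0 p_closed _] := polygonP p_in.
case: p' lift_p' => [|d r] [path_r fr]; first by rewrite -fr in p_gt0.
apply: contraT => open_r.
have : lift_open f p (org d) by apply/asboolP; exists (d :: r).
by rewrite lift_openE // ?flat ?perm1 ?eqxx // -fr /source /= org_emap.
Qed.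

Lemma def_cover_trivialized (R : realType) : (0 < n)%N ->
  def_cover R f = def_cocyc R alpha.
Proof.
move=> n_gt0; apply: avg_eq => _ /imfsetP[/= p0 p0_in ->].
apply: avg_eq => p p_in.
have {p0_in p_in} := polygon_orientations p0_in p_in.
case/polygonP/and3P=> p_gt0 p_closed _.
rewrite dh_same // /avg -cardE.
case: p p_gt0 p_closed => // e q _ p_closed.
have fibreE x' : (Some (vmap f x') == source (e :: q)) = (vmap f x' == org e).
  by [].
rewrite (eq_card (B := [pred v | vmap f v == org e])) //.
rewrite (card_triv_fibre f_triv) big_enum; congr (_ / _).
rewrite (eq_bigr (fun x' => (delta alpha (e :: q) (nu x') != nu x')%:R));
  last by move=> x' /eqP fx'; rewrite lift_openE.
transitivity (\sum_(xi : vertex X * 'I_n | xi.1 == org e)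
    (delta alpha (e :: q) xi.2 != xi.2)%:R : R).
  by rewrite (reindex _ (onW_bij _ (triv_vertex f_triv))).
rewrite (eq_bigl (fun xi => (xi.1 == org e) && true)); last first.
  by move=> xi; rewrite andbT.
rewrite -(pair_big (fun x => x == org e) xpredT
  (fun _ i => (delta alpha (e :: q) i != i)%:R : R)) /= big_pred1_eq.
by apply: eq_bigr => i _; rewrite perm1.
Qed.

End Lifting.

(** * The covering of a cochain *)

Section Sheets.

Variables (X : graph) (n : nat) (alpha : dart X -> 'S_n).
Hypothesis alpha_bar : forall e, alpha (bar e) = ((alpha e)^-1)%g.

Definition sheets_org (d : dart X * 'I_n) : vertex X * 'I_n :=
  (org d.1, alpha d.1 d.2).
Definition sheets_trm (d : dart X * 'I_n) : vertex X * 'I_n :=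
  (trm d.1, d.2).
Definition sheets_bar (d : dart X * 'I_n) : dart X * 'I_n :=
  (bar d.1, alpha d.1 d.2).

Fact sheets_barK d : sheets_bar (sheets_bar d) = d.
Proof. by case: d => e i; rewrite /sheets_bar /= barK alpha_bar permK. Qed.

Fact sheets_bar_neq d : sheets_bar d != d.
Proof. by apply: contraNneq (bar_neq d.1) => /(congr1 fst) /= ->. Qed.

Fact sheets_trm_bar d : sheets_trm (sheets_bar d) = sheets_org d.
Proof. by rewrite /sheets_trm /= trm_bar. Qed.

Definition sheets : graph := Graph sheets_barK sheets_bar_neq sheets_trm_bar.

Definition sheets_map : gmap sheets X :=
  @Gmap sheets X fst fst
    (fun=> erefl) (fun=> erefl) (fun=> erefl).

Lemma sheets_trivialization : trivialization sheets_map alpha snd.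
Proof. by split=> //; exists id; case. Qed.

End Sheets.

(** * Common subgraphs of two coverings *)

Fact gmap_comp_org (G H K : graph) (g : gmap H K) (f : gmap G H) e :
  org (emap g (emap f e)) = vmap g (vmap f (org e)).
Proof. by rewrite !org_emap. Qed.

Fact gmap_comp_trm (G H K : graph) (g : gmap H K) (f : gmap G H) e :
  trm (emap g (emap f e)) = vmap g (vmap f (trm e)).
Proof. by rewrite !trm_emap. Qed.

Fact gmap_comp_bar (G H K : graph) (g : gmap H K) (f : gmap G H) e :
  emap g (emap f (bar e)) = bar (emap g (emap f e)).
Proof. by rewrite !bar_emap. Qed.

Definition gmap_comp (G H K : graph) (g : gmap H K) (f : gmap G H) :
    gmap G K :=
  @Gmap G K (vmap g \o vmap f) (emap g \o emap f)
    (gmap_comp_org g f) (gmap_comp_trm g f) (gmap_comp_bar g f).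

Section Pullback.

Variables (X G Y : graph) (f : gmap G X) (g : gmap Y X).
Variables (nu : vertex G -> nat) (mu : vertex Y -> nat).

(** The fibre product of two coverings with numbered fibres, cut down to pairs
    with equal numbers; it is their largest common subgraph that respects the
    numbers. *)
Definition pullback_vertex : finType :=
  {v : vertex G * vertex Y | (vmap f v.1 == vmap g v.2) && (nu v.1 == mu v.2)}.

Definition pullback_dart_pred (d : dart G * dart Y) : bool :=
  [&& emap f d.1 == emap g d.2, nu (org d.1) == mu (org d.2) &
      nu (trm d.1) == mu (trm d.2)].

Definition pullback_dart : finType := {d | pullback_dart_pred d}.

Fact pullback_orgP (d : pullback_dart) :
  (vmap f (org (val d).1) == vmap g (org (val d).2)) &&
  (nu (org (val d).1) == mu (org (val d).2)).
Proof.
by case: d => d /= /and3P[/eqP fd -> _]; rewrite -!org_emap fd eqxx.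
Qed.

Fact pullback_trmP (d : pullback_dart) :
  (vmap f (trm (val d).1) == vmap g (trm (val d).2)) &&
  (nu (trm (val d).1) == mu (trm (val d).2)).
Proof.
by case: d => d /= /and3P[/eqP fd _ ->]; rewrite -!trm_emap fd eqxx.
Qed.

Fact pullback_barP (d : pullback_dart) :
  pullback_dart_pred (bar (val d).1, bar (val d).2).
Proof.
case: d => d /= /and3P[/eqP fd org_d trm_d]; rewrite /pullback_dart_pred /=.
by rewrite !org_bar !trm_bar !bar_emap fd org_d trm_d eqxx.
Qed.

Definition pullback_org (d : pullback_dart) : pullback_vertex :=
  exist _ (org (val d).1, org (val d).2) (pullback_orgP d).
Definition pullback_trm (d : pullback_dart) : pullback_vertex :=
  exist _ (trm (val d).1, trm (val d).2) (pullback_trmP d).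
Definition pullback_bar (d : pullback_dart) : pullback_dart :=
  exist _ (bar (val d).1, bar (val d).2) (pullback_barP d).

Fact pullback_barK d : pullback_bar (pullback_bar d) = d.
Proof. by apply: val_inj; case: d => -[d e] ?; rewrite /= !barK. Qed.

Fact pullback_bar_neq d : pullback_bar d != d.
Proof.
by apply: contraNneq (bar_neq (val d).1) => /(congr1 (fst \o val))/= ->.
Qed.

Fact pullback_trm_bar d : pullback_trm (pullback_bar d) = pullback_org d.
Proof. by apply: val_inj; rewrite /= !trm_bar. Qed.

Definition pullback : graph :=
  Graph pullback_barK pullback_bar_neq pullback_trm_bar.

Definition pullback_fst : gmap pullback G :=
  @Gmap pullback G (fst \o val) (fst \o val)
    (fun=> erefl) (fun=> erefl) (fun=> erefl).
Definition pullback_snd : gmap pullback Y :=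
  @Gmap pullback Y (snd \o val) (snd \o val)
    (fun=> erefl) (fun=> erefl) (fun=> erefl).

Definition pullback_map : gmap pullback X := gmap_comp f pullback_fst.

End Pullback.

(** The element [(e, i)] stands for the directed edge over [e] that ends at the
    points numbered [i] and that the coverings given by [alpha] and [phi] share. *)
Definition common_darts (X : graph) n N (alpha : dart X -> 'S_n)
    (phi : dart X -> 'S_N) : {set dart X * 'I_n} :=
  [set ei | ei.2 \in agreements (alpha ei.1) (phi ei.1)].

Lemma card_common_darts (X : graph) n N (alpha : dart X -> 'S_n)
    (phi : dart X -> 'S_N) :
  #|common_darts alpha phi| = (\sum_e #|agreements (alpha e) (phi e)|)%N.
Proof.
rewrite -sum1_card -(eq_bigr _ (fun e _ => sum1_card _)).
by rewrite pair_big_dep /=; apply: eq_bigl => ei; rewrite inE.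
Qed.

Section PullbackTrivialized.

Variables (X G Y : graph) (f : gmap G X) (g : gmap Y X) (n N : nat).
Variables (alpha : dart X -> 'S_n) (nu : vertex G -> 'I_n).
Variables (phi : dart X -> 'S_N) (mu : vertex Y -> 'I_N).
Hypothesis f_triv : trivialization f alpha nu.
Hypothesis g_triv : trivialization g phi mu.

Let A := pullback f g nu mu.
Let a : gmap A X := pullback_map f g nu mu.

Lemma pullback_vertexE (v w : vertex A) :
  vmap a v = vmap a w -> nu (val v).1 = nu (val w).1 -> v = w.
Proof.
case: v w => [[v1 v2] /= vP] [[w1 w2] /= wP] /= vw nvw; apply: val_inj => /=.
have {nvw vw} v1w1 := triv_vertex_inj f_triv vw nvw; subst w1.
case/andP: vP wP => /eqP fv1 /eqP nv1 /andP[/eqP fw2 /eqP nw2].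
congr pair; apply: (triv_vertex_inj g_triv); first by rewrite -fv1 -fw2.
by apply: val_inj; rewrite /= -nv1 -nw2.
Qed.

Lemma pullback_dartE (d e : dart A) :
  emap a d = emap a e -> trm d = trm e -> d = e.
Proof.
case: d e => [[d1 d2] /= dP] [[e1 e2] /= eP] /= de [td1 td2].
have d1e1 := triv_dart_inj f_triv de td1; apply: val_inj => /=; subst e1.
case/and3P: dP eP => /eqP fd1 _ _ /and3P[/eqP fe2 _ _].
by congr pair; apply: (triv_dart_inj g_triv); rewrite // -fd1 -fe2.
Qed.

Lemma pullback_embeds_fst : embeds a f.
Proof.
have inj_v : injective (vmap (pullback_fst f g nu mu)).
  by move=> v w /= vw; apply: pullback_vertexE; rewrite /= vw.
exists (pullback_fst f g nu mu); split=> // d e /= de.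
apply: pullback_dartE; first by rewrite /= de.
by apply: inj_v; rewrite /= de.
Qed.

Lemma pullback_embeds_snd : embeds a g.
Proof.
have fg (v : vertex A) : vmap g (val v).2 = vmap a v.
  by have /andP[/eqP/esym] := valP v.
have fg_dart (d : dart A) : emap g (val d).2 = emap a d.
  by have /and3P[/eqP/esym] := valP d.
have inj_v : injective (vmap (pullback_snd f g nu mu)).
  move=> v w /= vw; apply: pullback_vertexE; first by rewrite -!fg vw.
  apply: val_inj => /=.
  have /andP[_ /eqP->] := valP v; have /andP[_ /eqP->] := valP w.
  by rewrite vw.
exists (pullback_snd f g nu mu); split=> // d e /= de.
apply: pullback_dartE; first by rewrite -!fg_dart de.
by apply: inj_v; rewrite /= de.
Qed.

Lemma card_pullback_dart :
  (\sum_e #|agreements (alpha e) (phi e)| <= #|dart A|)%N.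
Proof.
rewrite -card_common_darts -[leqRHS]cardsT.
apply: leq_trans (leq_imset_card (fun d => (emap a d, nu (trm (val d).1))) _).
apply/subset_leq_card/fintype.subsetP => -[e i].
rewrite inE /= inE => /existsP[j].
case/andP=> /eqP ji /eqP agree; apply/imsetP.
have [v fv nv] := triv_vertex_over f_triv (trm e) i.
have [w gw mw] := triv_vertex_over g_triv (trm e) j.
have [d fd td] := triv_dart_over f_triv fv.
have [d' gd' td'] := triv_dart_over g_triv gw.
have dP : pullback_dart_pred f g nu mu (d, d').
  rewrite /pullback_dart_pred /= fd gd' eqxx.
  rewrite (triv_org f_triv) (triv_org g_triv) td td' nv mw fd gd'.
  by rewrite agree ji !eqxx.
by exists (exist _ (d, d') dP); rewrite ?inE //= fd td nv.
Qed.

End PullbackTrivialized.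

(** * The edit distance of two coverings *)

Lemma embeds_uedges_le (L A G : graph) (a : gmap A L) (g : gmap G L) :
  embeds a g -> (#|` uedges A| <= #|` uedges G|)%N.
Proof.
case=> h [_ _ _ h_inj].
by rewrite -(leq_pmul2r (isT : (0 < 2)%N)) !card_uedges (leq_card _ h_inj).
Qed.

Lemma max_common_edges_ge (L A G Y : graph) (a : gmap A L) (g : gmap G L)
    (y : gmap Y L) :
  embeds a g -> embeds a y -> (#|` uedges A| <= max_common_edges g y)%N.
Proof.
move=> ag ay; have lt_A : (#|` uedges A| < #|` uedges G|.+1)%N.
  by rewrite ltnS (embeds_uedges_le ag).
apply: (leq_bigmax_cond (Ordinal lt_A)) => /=.
by apply/asboolP; exists A, a.
Qed.

Lemma max_common_edges_attained (L A0 G Y : graph) (a0 : gmap A0 L)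
    (g : gmap G L) (y : gmap Y L) : embeds a0 g -> embeds a0 y ->
  exists (A : graph) (a : gmap A L),
    [/\ embeds a g, embeds a y & #|` uedges A| = max_common_edges g y].
Proof.
move=> ag ay; have lt_A : (#|` uedges A0| < #|` uedges G|.+1)%N.
  by rewrite ltnS (embeds_uedges_le ag).
pose P (m : 'I_#|` uedges G|.+1) := `[< exists (A : graph) (a : gmap A L),
  [/\ embeds a g, embeds a y & #|` uedges A| = m] >].
have : (0 < #|P|)%N.
  by apply/card_gt0P; exists (Ordinal lt_A); apply/asboolP; exists A0, a0.
case/(eq_bigmax_cond (@nat_of_ord _)) => m /asboolP common max_m.
by rewrite (_ : max_common_edges g y = m).
Qed.

Lemma max_common_edges_le (L G Y : graph) (g : gmap G L) (y : gmap Y L) :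
  (max_common_edges g y <= #|` uedges G|)%N.
Proof. by apply/bigmax_leqP => m _; rewrite -ltnS. Qed.

Lemma d_edit_ge0 (R : realType) (L G Y : graph) (g : gmap G L)
    (y : gmap Y L) : 0 <= d_edit R g y.
Proof.
rewrite /d_edit; case: eqP => // /eqP; rewrite -lt0n => M_gt0.
rewrite subr_ge0 ler_pdivrMr ?ltr0n // mul1r ler_nat.
by rewrite (leq_trans (max_common_edges_le g y)) ?leq_maxl.
Qed.

(** Both distances count, over all directed edges of [X] and all numbers up to
    [maxn n N], the proportion that is not shared. *)
Lemma d_edit_trivialized (R : realType) (X G Y : graph) (f : gmap G X)
    (g : gmap Y X) n N (alpha : dart X -> 'S_n) (nu : vertex G -> 'I_n)
    (phi : dart X -> 'S_N) (mu : vertex Y -> 'I_N) :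
    trivialization f alpha nu -> trivialization g phi mu ->
    (0 < maxn n N)%N ->
  d_edit R f g = if #|dart X| == 0%N then 0 else
    1 - (max_common_edges f g * 2)%:R / (maxn n N * #|dart X|)%:R.
Proof.
move=> f_triv g_triv max_gt0; rewrite /d_edit /=.
have uedges2 : (maxn #|` uedges G| #|` uedges Y| * 2 = maxn n N * #|dart X|)%N.
  by rewrite maxnMl !card_uedges (card_triv_dart f_triv) (card_triv_dart g_triv)
             -maxnMl.
have -> : (maxn #|` uedges G| #|` uedges Y| == 0)%N = (#|dart X| == 0)%N.
  apply/idP/idP=> /eqP z; move: uedges2; rewrite z ?muln0 ?mul0n => /eqP.
    by rewrite eq_sym muln_eq0 -[_ == 0%N]negbK -lt0n max_gt0.
  by rewrite muln_eq0 orbF.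
by rewrite -uedges2 !natrM -mulf_div divff ?mulr1 // pnatr_eq0.
Qed.

Lemma cochain_distE (R : realType) (X : polygonal_complex) n N
    (alpha : dart X -> 'S_n) (phi : dart X -> 'S_N) :
  cochain_dist R alpha phi = if #|dart X| == 0%N then 0 else
    1 - (\sum_e #|agreements (alpha e) (phi e)|)%:R /
        (maxn n N * #|dart X|)%:R.
Proof.
rewrite /cochain_dist avg_uedges; case: eqP => [-> | /eqP D0].
  by rewrite invr0 mulr0.
rewrite (eq_bigr _ (fun e _ => dhE R (alpha e) (phi e))).
rewrite sumrB -mulr_suml sumr_const mulrBl divff ?pnatr_eq0 //.
by rewrite natrM invfM mulrA natr_sum.
Qed.

Lemma cochain_dist_ge0 (R : realType) (X : polygonal_complex) n N
    (alpha : dart X -> 'S_n) (phi : dart X -> 'S_N) :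
  0 <= cochain_dist R alpha phi.
Proof. by do 2!apply: avg_ge0 => ?; apply: dh_ge0. Qed.

(** * From a nearby genuine covering to a nearby cocycle *)

Lemma delta_pad (X : polygonal_complex) N k (psi : dart X -> 'S_N) p :
  delta (fun e => pad k (psi e)) p = pad k (delta psi p).
Proof.
elim: p => [|e p IHp]; first by rewrite /delta !big_nil pad1.
by rewrite !delta_cons IHp padM.
Qed.

Lemma delta_nil (X : polygonal_complex) n (alpha : dart X -> 'S_n) :
  delta alpha [::] = 1%g.
Proof. exact: big_nil. Qed.

(** Renumbering the fibres by [s] conjugates the monodromy of closed paths, so it
    preserves cocycles: the factors at the inner vertices cancel. *)
Lemma delta_gauge (X : polygonal_complex) n (psi : dart X -> 'S_n)
    (s : vertex X -> 'S_n) e q : is_path (e :: q) ->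
  delta (fun e => (s (trm e))^-1 * psi e * s (org e))%g (e :: q) =
  ((s (last (trm e) (map trm q)))^-1 * delta psi (e :: q) * s (org e))%g.
Proof.
elim: q e => [|e' q IHq] e /=; first by rewrite !delta_cons !delta_nil !mul1g.
case/andP=> /eqP te /IHq IH; rewrite delta_cons IH te.
by rewrite [in RHS]delta_cons !mulgA mulgK.
Qed.

(** A common subgraph [A] of the two coverings gives, over each vertex [x], a
    partial bijection between the two fibres. The numbering of the fibres of [g]
    can be changed by permutations [s x] so that corresponding points get equal
    numbers, provided that [g] has at least the degree of [f]; adding
    [n - N] trivial sheets to [g] achieves this, and it does not change the
    maximum of the two degrees when [N < n]. In the new numbering every directed
    edge of [A] is an agreement. *)
Lemma cocycle_of_common_subgraph (X : polygonal_complex) (G Y : graph)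
    (f : gmap G X) (g : gmap Y X) n N
    (alpha : dart X -> 'S_n) (nu : vertex G -> 'I_n)
    (psi : dart X -> 'S_N) (mu : vertex Y -> 'I_N) :
    (2 <= n)%N -> trivialization f alpha nu -> trivialization g psi mu ->
    (forall p, p \in polygons X -> delta psi p = 1%g) ->
  exists phi : dart X -> 'S_(N + (n - N)), cocycle phi /\
    (max_common_edges f g * 2 <= \sum_e #|agreements (alpha e) (phi e)|)%N.
Proof.
move=> n_ge2 f_triv g_triv flat.
have [A [a [[h [ha_v ha_e h_inj_v h_inj]] [k [ka_v ka_e k_inj _]] <-]]] :=
  max_common_edges_attained (pullback_embeds_fst f_triv g_triv)
                            (pullback_embeds_snd f_triv g_triv).
have n_le : (n <= N + (n - N))%N by rewrite -maxnE leq_maxr.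
have relabel x : exists s : 'S_(N + (n - N)), forall v, vmap a v = x ->
    s (lshift _ (mu (vmap k v))) = widen_ord n_le (nu (vmap h v)).
  have [||s sE] := @perm_extends _ _ (fun v => lshift (n - N) (mu (vmap k v)))
    (fun v => widen_ord n_le (nu (vmap h v))) (enum [pred v | vmap a v == x]).
  - move=> v w; rewrite !mem_enum !inE => /eqP av /eqP aw /lshift_inj kvw.
    by apply: k_inj; apply: (triv_vertex_inj g_triv); rewrite ?ka_v ?av ?aw.
  - move=> v w; rewrite !mem_enum !inE => /eqP av /eqP aw.
    move=> /(congr1 val)/= /val_inj hvw; apply: h_inj_v.
    by apply: (triv_vertex_inj f_triv); rewrite ?ha_v ?av ?aw.
  by exists s => v av; apply: sE; rewrite mem_enum inE av.
have [s sE] := choice relabel.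
exists (fun e => (s (trm e))^-1 * pad (n - N) (psi e) * s (org e))%g; split.
  split=> [|p p_in].
    split=> [|e]; first by rewrite (leq_trans n_ge2).
    by rewrite org_bar trm_bar (triv_bar g_triv) padV !invMg invgK mulgA.
  have /and3P[p_gt0 /andP[path_p closed_p] _] := polygonP p_in.
  case: p p_in p_gt0 path_p closed_p => // e q p_in _ path_p.
  rewrite target_cons => /eqP[org_e].
  by rewrite delta_gauge // -org_e delta_pad flat // pad1 mulg1 mulVg.
rewrite card_uedges -card_common_darts -cardsT.
pose pos (d : dart A) := (emap a d, nu (trm (emap h d))).
rewrite -(card_imset _ (f := pos)).
  apply/subset_leq_card/fintype.subsetP => _ /imsetP[d _ ->].
  rewrite inE /= inE; apply/existsP.
  exists (widen_ord n_le (nu (trm (emap h d)))); rewrite eqxx /=.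
  have sE_trm : s (trm (emap a d)) (lshift _ (mu (trm (emap k d)))) =
      widen_ord n_le (nu (trm (emap h d))).
    by rewrite !trm_emap sE.
  have sE_org : s (org (emap a d)) (lshift _ (mu (org (emap k d)))) =
      widen_ord n_le (nu (org (emap h d))).
    by rewrite !org_emap sE.
  rewrite -sE_trm !permM permK pad_lshift -[in psi _]ka_e.
  by rewrite -(triv_org g_triv) sE_org /= (triv_org f_triv) ha_e.
move=> d e [ade nde]; apply: h_inj; apply: (bij_inj (triv_dart f_triv)).
by rewrite !ha_e ade nde.
Qed.

(** * Comparison of the defects *)

Lemma Def_cover_le_cochain_dist (R : realType) (X : polygonal_complex)
    (G : graph) (f : gmap G X) n (alpha : dart X -> 'S_n)
    (nu : vertex G -> 'I_n) m (phi : dart X -> 'S_m) :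
    trivialization f alpha nu -> (0 < m)%N ->
    (forall e, phi (bar e) = ((phi e)^-1)%g) ->
    (forall p, p \in polygons X -> delta phi p = 1%g) ->
  Def_cover R f <= cochain_dist R alpha phi.
Proof.
move=> f_triv m_gt0 phi_bar flat.
have phi_triv := sheets_trivialization phi_bar.
apply: (@le_trans _ _ (d_edit R f (sheets_map phi_bar))).
  apply: ge_inf; first by exists 0 => _ [Y [g [_ ->]]]; apply: d_edit_ge0.
  exists (sheets phi_bar), (sheets_map phi_bar); split=> //; split.
    exact: triv_covering phi_triv m_gt0.
  exact/(genuine_delta phi_triv).
rewrite cochain_distE (d_edit_trivialized R f_triv phi_triv); last first.
  by rewrite leq_max m_gt0 orbT.
case: eqP => // _; rewrite lerD2l lerN2 ler_wpM2r ?invr_ge0 ?ler0n // ler_nat.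
rewrite (leq_trans (card_pullback_dart f_triv phi_triv)) //.
rewrite -card_uedges leq_mul2r /=; apply: max_common_edges_ge.
  exact: (pullback_embeds_fst f_triv phi_triv).
exact: (pullback_embeds_snd f_triv phi_triv).
Qed.

Lemma Def_cocyc_le_d_edit (R : realType) (X : polygonal_complex)
    (G : graph) (f : gmap G X) n (alpha : dart X -> 'S_n)
    (nu : vertex G -> 'I_n) (Y : graph) (g : gmap Y X) :
    (2 <= n)%N -> trivialization f alpha nu -> genuine_covering g ->
  Def_cocyc R alpha <= d_edit R f g.
Proof.
move=> n_ge2 f_triv [g_cov g_genuine].
have [N [psi [mu [N_gt0 g_triv]]]] := covering_trivialization g_cov.
have [phi [phi_cocycle common_le]] := cocycle_of_common_subgraph n_ge2 f_triv
  g_triv ((genuine_delta g_triv).1 g_genuine).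
apply: (@le_trans _ _ (cochain_dist R alpha phi)).
  apply: ge_inf; last by exists (N + (n - N))%N, phi.
  by exists 0 => _ [m [phi' [_ ->]]]; apply: cochain_dist_ge0.
rewrite cochain_distE (d_edit_trivialized R f_triv g_triv); last first.
  by rewrite leq_max N_gt0 orbT.
case: eqP => // _.
have -> : maxn n (N + (n - N)) = maxn n N.
  by rewrite -maxnE (maxnC N) maxnA maxnn.
by rewrite lerD2l lerN2 ler_wpM2r ?invr_ge0 ?ler0n // ler_nat.
Qed.

Lemma cocycle1 (X : polygonal_complex) n : (2 <= n)%N ->
  cocycle (fun _ : dart X => 1%g : 'S_n).
Proof.
move=> n_ge2; split=> [|p _]; first by split=> // e; rewrite invg1.
by rewrite /delta big1_eq.
Qed.

Theorem theorem1p1 (R : realType) (X : polygonal_complex) (rho : R -> R)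
    (hX : graph_connected X) (hrho : rate_function rho) :
  cocycle_stable X rho <-> covering_stable X rho.
Proof.
have [rho_ge0 _ _] := hrho.
split=> [stable G f f_cov | stable n alpha [n_ge2 alpha_bar]].
  have [n [alpha [nu [n_gt0 f_triv]]]] := covering_trivialization f_cov.
  rewrite (def_cover_trivialized f_triv) //.
  have [n_lt2 | n_ge2] := ltnP n 2.
    (* Stability of cochains of degree at least 2 says nothing about a covering
       of degree 1, but such a covering is itself genuine. *)
    case: n n_gt0 n_lt2 alpha nu f_triv => [|[|n]] // _ _ alpha nu f_triv.
    have S1_trivial (s : 'S_1) : s = 1%g.
      by apply/permP => i; rewrite [LHS]ord1 [RHS]ord1.
    have Def_le : Def_cover R f <= cochain_dist R alpha alpha.
      apply: (Def_cover_le_cochain_dist R f_triv) => //.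
      exact: triv_bar f_triv.
    apply: le_trans Def_le _.
    rewrite [leLHS](_ : _ = 0) ?rho_ge0 //.
      by do 2!apply: avg_ge0 => ?; apply: dh_ge0.
    rewrite /cochain_dist avg_uedges big1 ?mul0r // => e _.
    by rewrite dh_same // big1 ?mul0r // => i _; rewrite eqxx.
  apply: le_trans (stable _ _ (conj n_ge2 (triv_bar f_triv))).
  apply: lb_le_inf.
    exists (cochain_dist R alpha (fun=> 1%g : 'S_2)), 2%N, (fun=> 1%g).
    by split; first exact: cocycle1.
  move=> _ [m [phi [[[m_ge2 phi_bar] flat] ->]]].
  by apply: (Def_cover_le_cochain_dist R f_triv); rewrite // ltnW.
have f_triv := sheets_trivialization alpha_bar.
have n_gt0 : (0 < n)%N by rewrite ltnW.
have := stable _ _ (triv_covering f_triv n_gt0).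
rewrite (def_cover_trivialized f_triv) //; apply: le_trans.
apply: lb_le_inf => [|_ [Y [g [g_genuine ->]]]]; last first.
  exact: (Def_cocyc_le_d_edit R n_ge2 f_triv g_genuine).
have [[_ one_bar] one_flat] := cocycle1 X (leqnn 2).
have one_triv := sheets_trivialization one_bar.
exists (d_edit R (sheets_map alpha_bar) (sheets_map one_bar)).
exists (sheets one_bar), (sheets_map one_bar); split=> //; split.
  exact: triv_covering one_triv isT.
exact/(genuine_delta one_triv).
Qed.
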